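(* Let $S_3=(x_3x_2x_1x_2x_1)(x_3x_2x_1x_2)x_3$ and $S_4=x_4S_3x_4S_3x_4S_3x_4S_3x_4$. The Garside elements of the Artin monoids $\mathcal{M}(H_3)$ and $\mathcal{M}(H_4)$ are $$\Delta(H_3)=x_1x_2x_1x_2x_1S_3=x_1x_2x_1x_2x_1\cdot(x_3x_2x_1x_2x_1)(x_3x_2x_1x_2)x_3,$$ $$\Delta(H_4)=x_1x_2x_1x_2x_1S_3S_4=x_1x_2x_1x_2x_1S_3x_4S_3x_4S_3x_4S_3x_4S_3x_4.$$
   Context: $\mathcal{M}(H_n)$, $n=3,4$, is the monoid with generators $x_1,\dots,x_n$ and relations $x_1x_2x_1x_2x_1=x_2x_1x_2x_1x_2$, $x_ix_{i+1}x_i=x_{i+1}x_ix_{i+1}$ for $2\le i\le n-1$, and $x_ix_j=x_jx_i$ for $|i-j|\ge2$. The notation $\alpha\mid_L\beta$ means $\beta=\alpha\rho$ for some element $\rho$. The Garside element $\Delta$ of such a monoid is the unique element such that $x_i\mid_L\Delta$ for all $i$, and whenever $x_i\mid_L\omega$ for all $i$ then $\Delta\mid_L\omega$. *)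

(* Defs.v *)
From HB Require Import structures.
From mathcomp Require Import all_boot.
From mathcomp Require Import boolp.

Set Implicit Arguments.
Unset Strict Implicit.
Unset Printing Implicit Defensive.

Local Open Scope quotient_scope.
Local Open Scope group_scope.

Section Presentation.
Variables (T : choiceType) (R : seq T -> seq T -> Prop).

(* The monoid congruence on the free monoid seq T generated by R. *)
Inductive word_cong : seq T -> seq T -> Prop :=
| cong_rel a b u v : R u v -> word_cong (a ++ u ++ b) (a ++ v ++ b)
| cong_refl u : word_cong u u
| cong_sym u v : word_cong u v -> word_cong v u
| cong_trans u v w : word_cong u v -> word_cong v w -> word_cong u w.

Lemma word_cong_cat u u' v v' :
  word_cong u u' -> word_cong v v' -> word_cong (u ++ v) (u' ++ v').
Proof.
move=> uu' vv'; apply: (@cong_trans _ (u' ++ v)).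
  elim: uu' {vv'} => [a b s t st|s|s t _|s t w _ st _ tw].
  - by rewrite -!catA; apply: cong_rel.
  - exact: cong_refl.
  - exact: cong_sym.
  - exact: cong_trans st tw.
elim: vv' {uu'} => [a b s t st|s|s t _|s t w _ st _ tw].
- by rewrite !(catA u' a); apply: cong_rel.
- exact: cong_refl.
- exact: cong_sym.
- exact: cong_trans st tw.
Qed.

(* {eq_quot _} needs a boolean relation, hence the classical `[< _ >]. *)
Definition word_congb : rel (seq T) := fun u v => `[< word_cong u v >].

Lemma word_congb_refl : reflexive word_congb.
Proof. by move=> u; apply/asboolP; apply: cong_refl. Qed.

Lemma word_congb_sym : symmetric word_congb.
Proof. by move=> u v; apply/asboolP/asboolP; apply: cong_sym. Qed.

Lemma word_congb_trans : transitive word_congb.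
Proof.
move=> v u w /asboolP uv /asboolP vw; apply/asboolP.
exact: cong_trans uv vw.
Qed.

Canonical word_congb_equiv :=
  EquivRel word_congb word_congb_refl word_congb_sym word_congb_trans.

Definition presented := {eq_quot word_congb}.

HB.instance Definition _ := Choice.on presented.
HB.instance Definition _ := Quotient.on presented.

Definition word (u : seq T) : presented := \pi_presented u.

Lemma wordP u v : word u = word v <-> word_cong u v.
Proof. by split=> [/eqmodP/asboolP|uv]; [|apply/eqmodP/asboolP]. Qed.

Lemma word_repr (a : presented) : word (repr a) = a.
Proof. exact: reprK. Qed.

Definition presented_mul (a b : presented) := word (repr a ++ repr b).

Lemma presented_mulE u v : presented_mul (word u) (word v) = word (u ++ v).
Proof. by apply/wordP; apply: word_cong_cat; apply/wordP; rewrite word_repr. Qed.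

Lemma presented_mulA : associative presented_mul.
Proof.
move=> a b c; rewrite -(word_repr a) -(word_repr b) -(word_repr c).
by rewrite !presented_mulE catA.
Qed.

Lemma presented_mul1g : left_id (word [::]) presented_mul.
Proof. by move=> a; rewrite -(word_repr a) presented_mulE. Qed.

Lemma presented_mulg1 : right_id (word [::]) presented_mul.
Proof. by move=> a; rewrite -(word_repr a) presented_mulE cats0. Qed.

HB.instance Definition _ := isMonoid.Build presented
  presented_mulA presented_mul1g presented_mulg1.

Lemma wordM u v : word u * word v = word (u ++ v).
Proof. exact: presented_mulE. Qed.

Lemma word1 : word [::] = 1.
Proof. by []. Qed.

End Presentation.

(* i : 'I_n stands for x_(i+1). For n = 3, 4 this is the presentation of the
   positive Artin monoid of type H_n. *)
Inductive H_rel (n : nat) : seq 'I_n -> seq 'I_n -> Prop :=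
| H_rel5 (i j : 'I_n) : i = 0%N :> nat -> j = 1%N :> nat ->
    H_rel [:: i; j; i; j; i] [:: j; i; j; i; j]
| H_rel3 (i j : 'I_n) : (1 <= i)%N -> j = i.+1 :> nat ->
    H_rel [:: i; j; i] [:: j; i; j]
| H_rel2 (i j : 'I_n) : (i.+2 <= j)%N || (j.+2 <= i)%N ->
    H_rel [:: i; j] [:: j; i].

Definition MH (n : nat) : monoidType := presented (@H_rel n).

Definition gen (n : nat) (i : 'I_n) : MH n := word (@H_rel n) [:: i].

(* x_ k is the 1-based generator x_k; meaningful only for 1 <= k <= n.+1. *)
Definition x_ {n : nat} (k : nat) : MH n.+1 := gen (inord k.-1).

Definition ldvd (M : monoidType) (a b : M) : Prop := exists r : M, b = a * r.

Definition is_Garside (M : monoidType) (I : Type) (x : I -> M) (d : M) : Prop :=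
  unique (fun e : M => (forall i, ldvd (x i) e) /\
                       (forall w : M, (forall i, ldvd (x i) w) -> ldvd e w)) d.

Definition S3 {n : nat} : MH n.+1 :=
  (x_ 3 * x_ 2 * x_ 1 * x_ 2 * x_ 1) * (x_ 3 * x_ 2 * x_ 1 * x_ 2) * x_ 3.

Definition S4 {n : nat} : MH n.+1 :=
  x_ 4 * S3 * x_ 4 * S3 * x_ 4 * S3 * x_ 4 * S3 * x_ 4.

(* Main.v *)
Require Import Defs.
From mathcomp Require Import all_boot.
From mathcomp Require Import zify.

(** Both presentations are complemented: two distinct generators [a] and [b]
    are the heads of exactly one relation [a . C a b = b . C b a], up to
    symmetry, and the relations preserve length.  By the theorem of Garside, in the form that
    Dehornoy gave it for complemented presentations, the relation
    [a . C a b = b . C b a] then computes the least common right multiple of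
    [a] and [b] as soon as a finite condition on triples of generators, the
    cube condition, holds ([head_lcm]).

    The computation rests on word reversing.  Completing two words [u] and [v]
    to a common right multiple, one relation at a time, gives words [p] and
    [q] with [u p = v q].  This equality always holds ([reverse_sound]).  If
    the relations give least common multiples of generators, then [u p] is
    moreover the least common right multiple of [u] and [v]
    ([reverse_complete]).  In the proof of [head_lcm] the latter is needed only
    for words shorter than those at hand, so an induction on length breaks the
    circle.  Reversing also decides the cube condition, which is therefore
    checked for all triples of generators of H_3 and H_4 by evaluation.

    Finally, reversing computes the least common multiple of all generators and
    shows that it is the stated word ([garside_criterion]).  Uniqueness follows
    from length: two elements that divide each other have the same length, so
    the quotient has length 0 and is 1. *)

Set Implicit Arguments.
Unset Strict Implicit.
Unset Printing Implicit Defensive.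

Local Open Scope group_scope.

(** * Word reversing in complemented presentations *)

Section Reversing.

Variables (T : choiceType) (R : seq T -> seq T -> Prop) (C : T -> T -> seq T).

Hypothesis rel_compl : forall u v, R u v ->
  exists a b, [/\ a != b, u = a :: C a b & v = b :: C b a].
Hypothesis compl_cong : forall a b, a != b ->
  word_cong R (a :: C a b) (b :: C b a).
Hypothesis size_compl : forall a b, size (C a b) = size (C b a).

Local Notation "u =~ v" := (word_cong R u v) (at level 70).

Lemma cong_size u v : u =~ v -> size u = size v.
Proof.
elim=> {u v} [a b u v /rel_compl [x [y [_ -> ->]]]|//|u v _ -> //|u v w _ -> _ //].
by rewrite !size_cat /= size_compl.
Qed.

Lemma cong_catl s u v : u =~ v -> s ++ u =~ s ++ v.
Proof. exact/word_cong_cat/cong_refl. Qed.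

Lemma cong_catr s u v : u =~ v -> u ++ s =~ v ++ s.
Proof. by move/word_cong_cat; apply; exact: cong_refl. Qed.

(** The result [Some (p, q)] completes [u] and [v] to the common right multiple
    [u ++ p], [v ++ q].  Reversing need not terminate in general, whence the
    fuel [n], which bounds the depth of the recursion. *)
Fixpoint reverse (n : nat) (u v : seq T) : option (seq T * seq T) :=
  if n isn't n'.+1 then None else
  match u, v with
  | [::], _ => Some (v, [::])
  | _, [::] => Some ([::], u)
  | a :: u', b :: v' =>
    if a == b then reverse n' u' v' else
    if reverse n' u' (C a b) is Some (p1, q1) then
      if reverse n' v' (C b a) is Some (p2, q2) then
        if reverse n' q1 q2 is Some (p, q) then Some (p1 ++ p, p2 ++ q)
        else None
      else None
    else None
  end.

(** The diagram filled in by [reverse] has [a . C a b = b . C b a] at its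
    corner, and its other three cells commute by induction. *)
Lemma reverse_sound n u v p q :
  reverse n u v = Some (p, q) -> u ++ p =~ v ++ q.
Proof.
elim: n u v p q => [|n IHn] [|a u] [|b v] p q //=.
- by case=> <- <-; apply: cong_refl.
- by case=> <- <-; rewrite cats0; apply: cong_refl.
- by case=> <- <-; rewrite cats0; apply: cong_refl.
case: eqVneq => [<-|ab]; first by move=> /IHn; apply: (cong_catl [:: a]).
case E1: (reverse n u _) => [[p1 q1]|//].
case E2: (reverse n v _) => [[p2 q2]|//].
case E3: (reverse n q1 q2) => [[p3 q3]|//] [<- <-].
apply: (@cong_trans _ _ _ (a :: C a b ++ q1 ++ p3)).
  rewrite !catA; apply: (cong_catl [:: a]); exact/cong_catr/(IHn _ _ _ _ E1).
apply: (@cong_trans _ _ _ (b :: C b a ++ q1 ++ p3)).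
  by rewrite -!cat_cons; apply/cong_catr/compl_cong.
apply: (@cong_trans _ _ _ (b :: C b a ++ q2 ++ q3)).
  rewrite -!cat_cons; exact/cong_catl/(IHn _ _ _ _ E3).
rewrite !catA; apply/(cong_catl [:: b])/cong_catr/cong_sym.
exact: (IHn _ _ _ _ E2).
Qed.

(** What an equality of [a :: X] and [b :: Y] should mean if the monoid is left
    cancellative and [a :: C a b] is a least common multiple of [a], [b]. *)
Definition head_related a X b Y : Prop :=
  if a == b then X =~ Y
  else exists W, X =~ C a b ++ W /\ Y =~ C b a ++ W.

Definition head_lcm_upto L : Prop := forall a X b Y,
  (size X < L)%N -> a :: X =~ b :: Y -> head_related a X b Y.

(** Every equation met while reversing concerns words no longer than the given
    ones, so the property of generators is needed up to that length only. *)
Lemma reverse_complete L n u v p q W V :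
    head_lcm_upto L -> reverse n u v = Some (p, q) ->
    (size (u ++ W) <= L)%N -> u ++ W =~ v ++ V ->
  exists S, W =~ p ++ S /\ V =~ q ++ S.
Proof.
move=> hL; elim: n u v p q W V => [|n IHn] [|a u] [|b v] p q W V //=.
- by case=> <- <- _ WV; exists V; split=> //; apply: cong_refl.
- by case=> <- <- _ WV; exists V; split=> //; apply: cong_refl.
- by case=> <- <- _ WV; exists W; split; [apply: cong_refl|apply: cong_sym].
move=> rev_uv leL /[dup] uv /(hL _ _ _ _ leL); rewrite /head_related.
move: rev_uv; case: eqVneq => [_|_]; first by move=> /IHn h; apply/h/ltnW.
case E1: (reverse n u _) => [[p1 q1]|//].
case E2: (reverse n v _) => [[p2 q2]|//].
case E3: (reverse n q1 q2) => [[p3 q3]|//] [<- <-] [S0 [uS vS]].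
have := cong_size uv => /= -[size_uv].
have [S1 [W1 S01]] := IHn _ _ _ _ _ _ E1 (ltnW leL) uS.
have [|S2 [V2 S02]] := IHn _ _ _ _ _ _ E2 _ vS.
  by rewrite -size_uv ltnW.
have [||S3 [S13 S23]] := IHn _ _ _ _ S1 S2 E3.
- rewrite -(cong_size S01); apply: leq_trans (ltnW leL).
  by rewrite (cong_size uS) size_cat leq_addl.
- by apply: cong_trans S02; apply: cong_sym.
exists S3; rewrite -!catA; split.
  by apply: cong_trans W1 _; apply: cong_catl.
by apply: cong_trans V2 _; apply: cong_catl.
Qed.

(** If [u ++ p] and [v ++ q] is the common multiple of [u := C k i] and
    [v := C k j], then the word for [lcm (k, i, j)] obtained through the faces
    [k, i] and [k, j] of the cube must be a multiple of the one given by the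
    third face [i, j], with the same cofactor on both sides. *)
Definition cube_condition n k i j : bool :=
  if reverse n (C k i) (C k j) is Some (p, q) then
    if reverse n (C i k ++ p) (C i j) is Some ([::], d) then
      if reverse n (C j k ++ q) (C j i) is Some ([::], e) then
        reverse n d e == Some ([::], [::])
      else false
    else false
  else false.

Lemma cube_conditionP n k i j : cube_condition n k i j ->
  exists p q d, [/\ reverse n (C k i) (C k j) = Some (p, q),
    C i k ++ p =~ C i j ++ d & C j k ++ q =~ C j i ++ d].
Proof.
rewrite /cube_condition.
case E1: (reverse n (C k i) _) => [[p q]|//].
case E2: (reverse n (C i k ++ p) _) => [[[|//] d]|//].
case E3: (reverse n (C j k ++ q) _) => [[[|//] e]|//] /eqP E4.
exists p, q, d; split=> //.
  by have := reverse_sound E2; rewrite cats0.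
have := reverse_sound E3; rewrite cats0 => /cong_trans; apply.
by apply: cong_catl; have := reverse_sound E4; rewrite !cats0; apply: cong_sym.
Qed.

Variable n : nat.
Hypothesis cube : forall k i j,
  k != i -> k != j -> i != j -> cube_condition n k i j.

Lemma head_related_sym a X b Y :
  head_related a X b Y -> head_related b Y a X.
Proof.
rewrite /head_related eq_sym; case: ifP => _; first exact: cong_sym.
by case=> W [hX hY]; exists W.
Qed.

(** The heart of the argument.  When [a], [c], [b] are distinct, the tail of
    the middle word is a multiple of both [C c a] and [C c b], hence of their
    least common multiple, and the cube condition transports it to the pair
    [a], [b]. *)
Lemma head_related_trans L a X c Z b Y :
    head_lcm_upto L -> (size Z <= L)%N ->
  head_related a X c Z -> head_related c Z b Y -> head_related a X b Y.
Proof.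
move=> hL leZ; rewrite /head_related.
case: (eqVneq a c) => [->|ac].
  move=> XZ; case: eqVneq => _; first exact: cong_trans.
  by case=> W [hZ hY]; exists W; split=> //; apply: cong_trans hZ.
case=> W [hX hZ]; case: (eqVneq c b) => [<-|cb].
  move=> ZY; rewrite (negPf ac); exists W; split=> //.
  by apply: cong_trans hZ; apply: cong_sym.
case=> V [hZ' hY].
have hWV : C c a ++ W =~ C c b ++ V.
  by apply: cong_trans hZ'; apply: cong_sym.
have leW : (size (C c a ++ W) <= L)%N by rewrite -(cong_size hZ).
case: eqVneq => [eab|ab].
  (* Both tails are now multiples of the same word, which the case of equal
     heads in [hL] cancels letter by letter. *)
  have cancel s : (size (s ++ W) <= L)%N -> s ++ W =~ s ++ V -> W =~ V.
    elim: s => //= x s IHs les /(hL _ _ _ _ les).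
    by rewrite /head_related eqxx; apply/IHs/ltnW.
  rewrite -eab in hWV hY; apply: cong_trans hX _; apply: cong_sym.
  by apply: cong_trans hY _; apply/cong_catl/cong_sym/(cancel (C c a)).
have ca : c != a by rewrite eq_sym.
have [p [q [d [rev_pq pd qd]]]] := cube_conditionP (cube ca cb ab).
have [S [WS VS]] := reverse_complete hL rev_pq leW hWV.
exists (d ++ S); split.
  apply: cong_trans hX _; apply: cong_trans (cong_catl _ WS) _.
  by rewrite !catA; apply: cong_catr.
apply: cong_trans hY _; apply: cong_trans (cong_catl _ VS) _.
by rewrite !catA; apply: cong_catr.
Qed.

(** The property of heads is read along a derivation of [u =~ v]: a relation
    applied at the head is one of the complement relations, one applied further
    on leaves the head alone, and [head_related_trans] composes the steps. *)
Lemma head_lcm_step L u v : head_lcm_upto L -> u =~ v ->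
    (size u <= L.+1)%N ->
  match u, v with
  | [::], [::] => True
  | a :: X, b :: Y => head_related a X b Y
  | _, _ => False
  end.
Proof.
move=> hL; elim=> {u v} [[|x s] t u v Ruv|[|a u]|u v uv IH|u v w uv IHu vw IHv].
- have [a [b [ab -> ->]]] := rel_compl Ruv => /= _.
  by rewrite /head_related (negPf ab); exists t; split; apply: cong_refl.
- by move=> _ /=; rewrite /head_related eqxx; apply: cong_rel.
- by [].
- by move=> _; rewrite /head_related eqxx; apply: cong_refl.
- rewrite -(cong_size uv) => /IH.
  by case: u v {uv IH} => [|a u] [|b v] //; apply: head_related_sym.
- move=> leu; have lev := leu; rewrite (cong_size uv) in lev.
  move: (IHu leu) (IHv lev) (lev).
  case: u v w {uv IHu vw IHv leu lev} => [|a u] [|c v] [|b w] //= ac cb lev.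
  exact: (head_related_trans hL lev ac cb).
Qed.

(** Induction on length is possible because [head_lcm_step] explains an
    equation of words of length [L.+1] by properties of shorter words. *)
Lemma head_lcm L : head_lcm_upto L.
Proof.
elim: L => [//|L IHL] a X b Y leX XY.
exact: (head_lcm_step IHL XY).
Qed.

(** * Least common multiples and Garside elements *)

Local Notation M := (presented R).

Lemma ldvd_wordP u (w : M) :
  ldvd (word R u) w <-> exists V, w = word R (u ++ V).
Proof.
split=> [[r ->]|[V ->]]; last by exists (word R V); rewrite wordM.
by exists (repr r); rewrite -wordM word_repr.
Qed.

Lemma reverse_lcm m u v p q (w : M) : reverse m u v = Some (p, q) ->
  ldvd (word R u) w -> ldvd (word R v) w -> ldvd (word R (u ++ p)) w.
Proof.
move=> rev_uv /ldvd_wordP [W ->] /ldvd_wordP [V /wordP uv].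
have [S [WS _]] := reverse_complete (@head_lcm _) rev_uv (leqnn _) uv.
by exists (word R S); rewrite wordM -catA; apply/wordP/cong_catl.
Qed.

(** Cofactors have length 0, since congruent words have the same length. *)
Lemma ldvd_anti (d e : M) : ldvd d e -> ldvd e d -> d = e.
Proof.
rewrite -(word_repr d) -(word_repr e).
move=> /ldvd_wordP [V eV] /ldvd_wordP [W dW].
have /cong_size := (wordP _ _ _).1 eV; have /cong_size := (wordP _ _ _).1 dW.
rewrite !size_cat => szd sze.
have /size0nil V0 : size V = 0%N by lia.
by rewrite eV V0 cats0.
Qed.

Fixpoint lcm_word (u s : seq T) : option (seq T) :=
  if s isn't a :: s' then Some u else
  if reverse n u [:: a] is Some (p, _) then lcm_word (u ++ p) s' else None.

Lemma lcm_wordP u s d (w : M) : lcm_word u s = Some d ->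
    ldvd (word R u) w -> (forall a, ldvd (word R [:: a]) w) ->
  ldvd (word R d) w.
Proof.
elim: s u => [|a s IHs] u /=; first by case=> ->.
case E: (reverse _ _ _) => [[p q]|//] /IHs h uw sw.
exact/h/sw/(reverse_lcm E uw).
Qed.

Definition reverses_to_multiple d a : bool :=
  if reverse n d [:: a] is Some ([::], _) then true else false.

(** The word [e] is a least common multiple of the generators; [d] may be
    another word for the same element. *)
Lemma garside_criterion (s d e : seq T) :
    (forall a, reverses_to_multiple d a) ->
    lcm_word [::] s = Some e -> reverse n d e = Some ([::], [::]) ->
  is_Garside (fun a => word R [:: a]) (word R d).
Proof.
move=> dvd_d lcm_e rev_de.
have gen_d a : ldvd (word R [:: a]) (word R d).
  have := dvd_d a; rewrite /reverses_to_multiple.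
  case E: (reverse n d _) => [[[|//] r]|//] _.
  have := reverse_sound E; rewrite cats0 => da.
  by apply/ldvd_wordP; exists r; apply/wordP.
have least_d w : (forall a, ldvd (word R [:: a]) w) -> ldvd (word R d) w.
  have -> : word R d = word R e.
    by apply/wordP; have := reverse_sound rev_de; rewrite !cats0.
  by apply: (lcm_wordP lcm_e); exists w; rewrite word1 mul1g.
split=> // c [gen_c least_c]; exact: ldvd_anti (least_d _ gen_c) (least_c _ gen_d).
Qed.

End Reversing.

(** * The monoids of type H_3 and H_4 *)

Definition H_compl n (i j : 'I_n) : seq 'I_n :=
  if (i.+2 <= j)%N || (j.+2 <= i)%N then [:: j]
  else if (i == 0%N :> nat) || (j == 0%N :> nat) then [:: j; i; j; i]
  else [:: j; i].

Lemma H_rel_compl n u v : @H_rel n u v ->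
  exists a b, [/\ a != b, u = a :: H_compl a b & v = b :: H_compl b a].
Proof.
case=> [i j i0 j1|i j i1 ji|i j far]; exists i, j; rewrite -val_eqE /= /H_compl.
- by rewrite i0 j1.
- have -> : (i.+2 <= j)%N || (j.+2 <= i)%N = false by lia.
  have -> : (j.+2 <= i)%N || (i.+2 <= j)%N = false by lia.
  have -> : (i == 0 :> nat)%N || (j == 0 :> nat)%N = false by lia.
  have -> : (j == 0 :> nat)%N || (i == 0 :> nat)%N = false by lia.
  by split=> //; lia.
- by rewrite far orbC far; split=> //; lia.
Qed.

Lemma H_compl_size n (i j : 'I_n) : size (H_compl i j) = size (H_compl j i).
Proof.
by rewrite /H_compl orbC (orbC (i == _ :> nat)); case: ifP => // _; case: ifP.
Qed.

Lemma H_compl_cong n (i j : 'I_n) : i != j ->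
  word_cong (@H_rel n) (i :: H_compl i j) (j :: H_compl j i).
Proof.
have rel u v : H_rel u v -> word_cong (@H_rel n) u v.
  by move=> uv; rewrite -[u]cats0 -[v]cats0; apply: (cong_rel [::]).
rewrite /H_compl (orbC (j.+2 <= i)%N) (orbC (j == _ :> nat)) -val_eqE /= => ij.
case: ifP => far; first exact/rel/H_rel2.
case: ifP => zero.
  have [[i0 j1]|[j0 i1]] : (i = 0 :> nat /\ j = 1 :> nat)%N \/
                           (j = 0 :> nat /\ i = 1 :> nat)%N by lia.
    exact/rel/H_rel5.
  exact/cong_sym/rel/H_rel5.
case: (ltngtP i j) => [lij|lji|eij]; last by rewrite eij eqxx in ij.
  by apply/rel/H_rel3; lia.
by apply/cong_sym/rel/H_rel3; lia.
Qed.

Definition H_garside n := garside_criterion (@H_rel_compl n)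
  (@H_compl_cong n) (@H_compl_size n).

(** Any fuel for which the evaluations below return a result would do. *)
Definition fuel : nat := 200.

Lemma H3_cube (k i j : 'I_3) : k != i -> k != j -> i != j ->
  cube_condition (@H_compl 3) fuel k i j.
Proof.
by case: k i j => [[|[|[|//]]] ?] [[|[|[|//]]] ?] [[|[|[|//]]] ?] //= _ _ _;
  vm_compute.
Qed.

Lemma H4_cube (k i j : 'I_4) : k != i -> k != j -> i != j ->
  cube_condition (@H_compl 4) fuel k i j.
Proof.
by case: k i j => [[|[|[|[|//]]]] ?] [[|[|[|[|//]]]] ?] [[|[|[|[|//]]]] ?] //=
  _ _ _; vm_compute.
Qed.

Definition x_word n (s : seq nat) : MH n.+1 :=
  word (@H_rel n.+1) [seq inord k.-1 | k <- s].

Lemma x_wordE n k : x_ k = x_word n [:: k].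
Proof. by []. Qed.

Lemma x_wordM n s t : x_word n s * x_word n t = x_word n (s ++ t).
Proof. by rewrite /x_word map_cat -wordM. Qed.

(** Evaluation of [inord k] is stuck on the opaque reflection lemma [idP];
    that of a literal ordinal is not. *)
Lemma inord_literal n k (lt_kn : (k < n.+1)%N) : inord k = Ordinal lt_kn.
Proof. exact/val_inj/inordK. Qed.

Lemma H3_Garside :
  is_Garside (@gen 3) (x_ 1 * x_ 2 * x_ 1 * x_ 2 * x_ 1 * S3).
Proof.
rewrite /S3 !x_wordE !x_wordM /x_word /=.
rewrite (inord_literal (isT : 0 < 3)%N) (inord_literal (isT : 1 < 3)%N).
rewrite (inord_literal (isT : 2 < 3)%N).
pose s : seq 'I_3 := [:: @Ordinal 3 0 isT; @Ordinal 3 1 isT; @Ordinal 3 2 isT].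
apply: (H_garside H3_cube (s := s)).
- by case=> [[|[|[|//]]] ?]; vm_compute.
- by vm_compute.
- by vm_compute.
Qed.

Lemma H4_Garside :
  is_Garside (@gen 4) (x_ 1 * x_ 2 * x_ 1 * x_ 2 * x_ 1 * S3 * S4).
Proof.
rewrite /S4 /S3 !x_wordE !x_wordM /x_word /=.
rewrite (inord_literal (isT : 0 < 4)%N) (inord_literal (isT : 1 < 4)%N).
rewrite (inord_literal (isT : 2 < 4)%N) (inord_literal (isT : 3 < 4)%N).
pose s : seq 'I_4 := [:: @Ordinal 4 0 isT; @Ordinal 4 1 isT;
                         @Ordinal 4 2 isT; @Ordinal 4 3 isT].
apply: (H_garside H4_cube (s := s)).
- by case=> [[|[|[|[|//]]]] ?]; vm_compute.
- by vm_compute.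
- by vm_compute.
Qed.

Theorem corollary6 :
  (is_Garside (@gen 3) (x_ 1 * x_ 2 * x_ 1 * x_ 2 * x_ 1 * S3) /\
   x_ 1 * x_ 2 * x_ 1 * x_ 2 * x_ 1 * S3 =
     x_ 1 * x_ 2 * x_ 1 * x_ 2 * x_ 1 *
       ((x_ 3 * x_ 2 * x_ 1 * x_ 2 * x_ 1) * (x_ 3 * x_ 2 * x_ 1 * x_ 2) * x_ 3)
     :> MH 3) /\
  (is_Garside (@gen 4) (x_ 1 * x_ 2 * x_ 1 * x_ 2 * x_ 1 * S3 * S4) /\
   x_ 1 * x_ 2 * x_ 1 * x_ 2 * x_ 1 * S3 * S4 =
     x_ 1 * x_ 2 * x_ 1 * x_ 2 * x_ 1 * S3 *
       x_ 4 * S3 * x_ 4 * S3 * x_ 4 * S3 * x_ 4 * S3 * x_ 4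
     :> MH 4).
Proof.
split; split; [exact: H3_Garside|by rewrite /S3|exact: H4_Garside|].
by rewrite /S4; move: S3 => s; rewrite !mulgA.
Qed.
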